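(* The collection of functions $f\in B(\mathring S^{d-1})$ such that $\dim_{\rm B}(K(f))=d$ is a residual subset of $B(\mathring S^{d-1})$.
   Context: $\mathring S^{d-1}$ denotes the unit sphere in $\mathbb{R}^d$ with antipodal points identified. $B(\mathring S^{d-1})$ denotes the Banach space of all bounded maps $f:\mathring S^{d-1}\to\mathbb{R}^d$ (no continuity or measurability assumed) with the supremum norm $\|f\|_\infty=\sup_{x}|f(x)|$. For $f\in B(\mathring S^{d-1})$ define \[ K(f)=\bigcup_{x\in\mathring S^{d-1}}\ \bigcup_{t\in[-1/2,1/2]}\{f(x)+tx\}\subseteq\mathbb{R}^d, \] i.e. the union over all directions $x$ of the closed unit line segment in direction $x$ centred at $f(x)$ (this segment does not depend on which of the two antipodal representatives of $x$ is used). For bounded $A\subseteq\mathbb{R}^d$, the upper box-counting dimension is $\dim_{\rm B}(A)=\limsup_{\epsilon\to0}\frac{\log N(A,\epsilon)}{-\log\epsilon}$, where $N(A,\epsilon)$ is the minimum number of balls of radius $\epsilon$ required to cover $A$. A set is nowhere dense if its closure has empty interior; a set is residual if its complement is a countable union of nowhere dense sets. *)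

(* Defs.v *)
From HB Require Import structures.
From mathcomp Require Import all_boot all_order all_algebra.
From mathcomp Require Import all_classical all_reals all_analysis.
From mathcomp Require Import ring lra.

Set Implicit Arguments.
Unset Strict Implicit.
Unset Printing Implicit Defensive.

Import Order.TTheory GRing.Theory Num.Theory.
Import numFieldNormedType.Exports.

Local Open Scope classical_set_scope.
Local Open Scope ring_scope.
Local Open Scope quotient_scope.

(* The library norm on 'rV[R]_d is the maximum norm, so R^d is an alias of
   'rV[R]_d carrying the Euclidean norm, and the balls and topology that come
   with it. *)
Definition euclid (R : realType) (d : nat) : Type := 'rV[R]_d.

Section euclid_norm.
Variables (R : realType) (d : nat).
Implicit Types x y : 'rV[R]_d.

Definition enorm x : R := Num.sqrt (\sum_i x 0 i ^+ 2).

Let sqsum_ge0 x : 0 <= \sum_i x 0 i ^+ 2.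
Proof. by apply: sumr_ge0 => i _; exact: sqr_ge0. Qed.

Lemma cauchy_schwarz x y :
  (\sum_i x 0 i * y 0 i) ^+ 2 <= (\sum_i x 0 i ^+ 2) * (\sum_i y 0 i ^+ 2).
Proof.
have : 0 <= \sum_i \sum_j (x 0 i * y 0 j - x 0 j * y 0 i) ^+ 2.
  by apply: sumr_ge0 => i _; apply: sumr_ge0 => j _; exact: sqr_ge0.
have -> : \sum_i \sum_j (x 0 i * y 0 j - x 0 j * y 0 i) ^+ 2 =
    \sum_i \sum_j (x 0 i ^+ 2 * y 0 j ^+ 2) +
    \sum_i \sum_j (x 0 j ^+ 2 * y 0 i ^+ 2) -
    (\sum_i \sum_j ((x 0 i * y 0 i) * (x 0 j * y 0 j))) *+ 2.
  rewrite -sumrMnl -sumrN -!big_split /=; apply: eq_bigr => i _.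
  rewrite -sumrMnl -sumrN -!big_split /=; apply: eq_bigr => j _.
  by ring.
rewrite [X in _ + X - _]exchange_big /=.
have E (a b : 'I_d -> R) :
    \sum_i \sum_j (a i * b j) = (\sum_i a i) * (\sum_j b j).
  by rewrite mulr_suml; apply: eq_bigr => i _; rewrite mulr_sumr.
rewrite !E; lra.
Qed.

Lemma enormD x y : enorm (x + y) <= enorm x + enorm y.
Proof.
rewrite /enorm -[leRHS]ger0_norm ?addr_ge0 ?sqrtr_ge0// -sqrtr_sqr.
rewrite ler_wsqrtr// sqrrD !sqr_sqrtr ?sqsum_ge0//.
have -> : \sum_i (x + y) 0 i ^+ 2 = \sum_i x 0 i ^+ 2 +
    (\sum_i x 0 i * y 0 i) *+ 2 + \sum_i y 0 i ^+ 2.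
  rewrite -sumrMnl -!big_split /=; apply: eq_bigr => i _.
  by rewrite mxE sqrrD.
rewrite lerD2r lerD2l lerMn2r/= -sqrtrM ?sqsum_ge0//.
rewrite (le_trans (ler_norm _))// -sqrtr_sqr ler_wsqrtr//.
exact: cauchy_schwarz.
Qed.

Lemma enormZ (a : R) x : enorm (a *: x) = `|a| * enorm x.
Proof.
rewrite /enorm -sqrtr_sqr -sqrtrM ?sqr_ge0//; congr Num.sqrt.
by rewrite mulr_sumr; apply: eq_bigr => i _; rewrite mxE exprMn.
Qed.

Lemma enorm0_eq0 x : enorm x = 0 -> x = 0.
Proof.
move=> /eqP; rewrite sqrtr_eq0 => x0; apply/rowP => i; rewrite mxE.
have /eqP : \sum_i x 0 i ^+ 2 = 0 by apply/eqP; rewrite eq_le x0 sqsum_ge0.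
rewrite psumr_eq0; last by move=> j _; exact: sqr_ge0.
by move=> /allP/(_ i (mem_index_enum _)); rewrite sqrf_eq0 => /eqP.
Qed.

HB.instance Definition _ := GRing.Lmodule.copy (euclid R d) 'rV[R]_d.

HB.instance Definition _ :=
  Lmodule_isNormed.Build R (euclid R d) enormD enormZ enorm0_eq0.

Lemma euclid_normE (x : euclid R d) :
  `|x| = Num.sqrt (\sum_i (x : 'rV[R]_d) 0 i ^+ 2).
Proof. by []. Qed.

End euclid_norm.

Section projective_sphere.
Variables (R : realType) (d : nat).

Definition usphere := {x : euclid R d | `|x| == 1}.

Definition antipodal (x y : usphere) : bool :=
  (val x == val y) || (val x == - val y).

Lemma antipodal_refl : reflexive antipodal.
Proof. by move=> x; rewrite /antipodal eqxx. Qed.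

Lemma antipodal_sym : symmetric antipodal.
Proof.
by move=> x y; rewrite /antipodal eq_sym (eq_sym (val x)) eqr_oppLR.
Qed.

Lemma antipodal_trans : transitive antipodal.
Proof.
move=> y x z; rewrite /antipodal => /orP[]/eqP-> /orP[]/eqP->;
  by rewrite ?opprK eqxx ?orbT.
Qed.

Definition antipodal_equiv :=
  EquivRel antipodal antipodal_refl antipodal_sym antipodal_trans.

Definition psphere := {eq_quot antipodal_equiv}.

End projective_sphere.

Section bounded_maps.
Variables (R : realType) (T : Type) (V : normedModType R).

Definition bounded_map : {pred T -> V} := [pred f | `[< bounded_fun f >]].

Lemma bounded_mapP (f : T -> V) :
  reflect (exists M : R, forall x, `|f x| <= M) (f \in bounded_map).
Proof.
apply: (iffP (asboolP _)) => [[M [_ /(_ (M + 1))]]|[M fM]].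
  by rewrite ltrDl ltr01 => /(_ isT) fM; exists (M + 1) => x; exact: fM.
by exists M; split; [exact: num_real|move=> N /ltW MN x _; exact: le_trans MN].
Qed.

Lemma bounded_map_submod_closed : submod_closed bounded_map.
Proof.
split; first by apply/bounded_mapP; exists 0 => x; rewrite normr0.
move=> a f g /bounded_mapP[M fM] /bounded_mapP[N gN].
apply/bounded_mapP; exists (`|a| * M + N) => x.
by rewrite (le_trans (ler_normD _ _))// lerD// normrZ ler_wpM2l.
Qed.

HB.instance Definition _ :=
  GRing.isSubmodClosed.Build _ _ bounded_map bounded_map_submod_closed.

Record bmap := BMap { bmap_fun :> T -> V ; _ : bmap_fun \in bounded_map }.

HB.instance Definition _ := [isSub for bmap_fun].
HB.instance Definition _ := [Choice of bmap by <:].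
HB.instance Definition _ := [SubChoice_isSubLmodule of bmap by <:].

Definition supnorm (f : bmap) : R := sup [set `|f x| | x in [set: T]].

Let has_ub_norm (f : bmap) : has_ubound [set `|f x| | x in [set: T]].
Proof.
have /bounded_mapP[M fM] := valP f.
by exists M => _ [x _ <-]; exact: fM.
Qed.

Lemma le_supnorm (f : bmap) x : `|f x| <= supnorm f.
Proof. by apply: ub_le_sup; [exact: has_ub_norm|exists x]. Qed.

Lemma supnorm_le (f : bmap) (M : R) :
  0 <= M -> (forall x, `|f x| <= M) -> supnorm f <= M.
Proof.
move=> M0 fM; have [[r Er]|/set0P/negP/negPn/eqP E0] :=
  pselect ([set `|f x| | x in [set: T]] !=set0).
  by apply: ge_sup => [|_ [x _ <-]]; [exists r|exact: fM].
by rewrite /supnorm E0 sup0.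
Qed.

Lemma supnorm_ge0 (f : bmap) : 0 <= supnorm f.
Proof.
have [[_ [x _ _]]|/set0P/negP/negPn/eqP E0] :=
  pselect ([set `|f x| | x in [set: T]] !=set0).
  by rewrite (le_trans _ (le_supnorm f x)).
by rewrite /supnorm E0 sup0.
Qed.

Lemma supnormD (f g : bmap) : supnorm (f + g) <= supnorm f + supnorm g.
Proof.
apply: supnorm_le => [|x]; first by rewrite addr_ge0 ?supnorm_ge0.
by rewrite (le_trans (ler_normD _ _))// lerD ?le_supnorm.
Qed.

Lemma supnormZ (a : R) (f : bmap) : supnorm (a *: f) = `|a| * supnorm f.
Proof.
have le (b : R) (g : bmap) : supnorm (b *: g) <= `|b| * supnorm g.
  apply: supnorm_le => [|x]; first by rewrite mulr_ge0 ?supnorm_ge0.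
  by rewrite normrZ ler_wpM2l ?le_supnorm.
apply/eqP; rewrite eq_le le /=; have [->|a0] := eqVneq a 0.
  by rewrite normr0 mul0r supnorm_ge0.
rewrite -ler_pdivlMl ?normr_gt0// -normfV.
by rewrite -[in leLHS](scalerK a0 f); exact: le.
Qed.

Lemma supnorm0_eq0 (f : bmap) : supnorm f = 0 -> f = 0.
Proof.
move=> f0; apply/val_inj/funext => x /=; apply/eqP.
by rewrite -normr_le0 -f0 le_supnorm.
Qed.

HB.instance Definition _ :=
  Lmodule_isNormed.Build R bmap supnormD supnormZ supnorm0_eq0.

End bounded_maps.

Section box_dimension.
Variables (R : realType) (V : normedModType R).
Implicit Types (A : set V) (e : R).

Definition ball_cover A e (n : nat) : Prop :=
  exists c : 'I_n -> V, A `<=` \bigcup_i ball (c i) e.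

(* The value 0 when there is no finite cover is a default; it is not reached
   for bounded subsets of R^d and e > 0. *)
Definition covering_number A e : nat :=
  if pselect (exists n, `[< ball_cover A e n >]) is left ex
  then ex_minn ex else 0%N.

Definition upper_box_dim A : \bar R :=
  limf_esup (fun e => (ln (covering_number A e)%:R / - ln e)%:E) (0 : R)^'+.

End box_dimension.

Section kakeya.
Variables (R : realType) (d : nat).

Definition kakeya (f : bmap (psphere R d) (euclid R d)) : set (euclid R d) :=
  \bigcup_(x in [set: psphere R d])
    \bigcup_(t in `[- (1 / 2), 1 / 2]) [set f x + t *: val (repr x)].

Lemma kakeya_reprE (f : bmap (psphere R d) (euclid R d)) :
  kakeya f = \bigcup_(u in [set: usphere R d])
    \bigcup_(t in `[- (1 / 2), 1 / 2]) [set f (\pi u) + t *: val u].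
Proof.
apply/seteqP; split=> y [x _ [t tI ->]].
  by exists (repr x) => //; exists t => //=; rewrite reprK.
exists (\pi x) => //.
have /eqmodP/orP[/eqP E|/eqP E] := reprK (\pi_(psphere R d) x).
- by exists t => //; rewrite E.
- exists (- t); last by rewrite /= E scalerN scaleNr opprK.
  by move: tI; rewrite /= !in_itv/= lerN2 lerNl andbC.
Qed.

End kakeya.

Definition nowhere_dense (X : topologicalType) (A : set X) : Prop :=
  interior (closure A) = set0.

Definition residual (X : topologicalType) (A : set X) : Prop :=
  exists F : nat -> set X,
    (forall n, nowhere_dense (F n)) /\ ~` A = \bigcup_n F n.

(* Main.v *)
Require Import Defs.
From mathcomp Require Import all_boot all_order all_algebra.
From mathcomp Require Import all_classical all_reals all_analysis.
From mathcomp Require Import lra.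

(** The upper box dimension of [kakeya f] is at most [d] for every [f], because
    a bounded subset of R^d is covered by O(e^-d) balls of radius [e] centred on
    a grid ([grid_cover], [upper_box_dim_bounded]). It is at least [d] as soon
    as, for every [n], some scale [e < 1/(n+1)] satisfies
    [ln N(kakeya f, e) / - ln e > d - 1/(n+1)]. So it is enough that, for each
    [n], the set of the [f] that have such a scale contains a dense open set.

    Density comes from maps with finitely many values, which are dense among the
    bounded maps ([finite_valued_approx]). If [g] takes only the values
    c_1, ..., c_m, then the [m] translates [kakeya g - c_i] together contain the
    closed ball of radius 1/2 around the origin: a point of that ball lies on
    the centred segment in its own direction [x], and the segment of [kakeya g]
    in direction [x] is this one moved by the value [g x], which is some c_i.
    Hence [m * N(kakeya g, e)] is at least the covering number of a ball, which
    is of the order of e^-d, and the constant factor [m] disappears in the limit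
    [ln N / - ln e].

    Openness comes from the same count, carried out with a margin: if [h] is
    uniformly within [e] of [g], then the translates of [kakeya h] still come
    within [e] of every point of the half ball ([kakeya_translates_cover]), so
    that the lower bound at scale [e] holds on the whole ball of radius [e]
    around [g] ([kakeya_covering_number_ge]). *)

Set Implicit Arguments.
Unset Strict Implicit.
Unset Printing Implicit Defensive.
Import Order.TTheory GRing.Theory Num.Theory.
Import numFieldNormedType.Exports.
Local Open Scope classical_set_scope.
Local Open Scope ring_scope.
Local Open Scope quotient_scope.

(** * Baire category *)

Section BaireCategory.

(** The hypothesis says that the interior of [G] is dense, phrased with balls so
    that a quantitative estimate can be plugged in. *)
Lemma nowhere_denseC (R : realType) (V : normedModType R) (G : set V) :
  (forall f r, 0 < r -> exists g s, [/\ 0 < s, ball f r g & ball g s `<=` G]) ->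
  nowhere_dense (~` G).
Proof.
move=> densG; apply/seteqP; split=> // f.
rewrite /interior => /nbhs_ballP[r /= r0 fr].
have [g [s [s0 fg gs]]] := densG f r r0.
have [h [nGh gh]] := fr _ fg (ball g s) (nbhsx_ballx g s s0).
exact: nGh (gs _ gh).
Qed.

Lemma nowhere_dense_subset (X : topologicalType) (A B : set X) :
  A `<=` B -> nowhere_dense B -> nowhere_dense A.
Proof.
rewrite /nowhere_dense => AB B0; rewrite -subset0 -B0.
exact: interiorS (closureS AB).
Qed.

(** [residual] asks for the complement of [A] to be equal to a countable union;
    cutting each exceptional set down to that complement turns the inclusion
    into an equality. *)
Lemma residual_bigcap (X : topologicalType) (A : set X) (G : nat -> set X) :
  (forall n, nowhere_dense (~` G n)) -> \bigcap_n G n `<=` A -> residual A.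
Proof.
move=> ndG GA; exists (fun n => ~` A `&` ~` G n); split=> [n|].
  by apply: nowhere_dense_subset (ndG n) => f [].
apply/seteqP; split=> [f nAf|f [n _ []]//].
apply: contrapT => nF; apply/nAf/GA => n _.
by apply: contrapT => nGf; apply: nF; exists n.
Qed.

End BaireCategory.

(** * Coverings and packings by balls *)

Section Coverings.
Context {R : realType} {V : normedModType R}.
Implicit Types (A B : set V) (e : R).

Lemma ball_coverS A B e n : A `<=` B -> ball_cover B e n -> ball_cover A e n.
Proof. by move=> AB [c Bc]; exists c; apply: subset_trans Bc. Qed.

Lemma ball_cover_fin (T : finType) A e (c : T -> V) :
  A `<=` \bigcup_i ball (c i) e -> ball_cover A e #|T|.
Proof.
move=> Ac; exists (c \o enum_val) => y /Ac[i _ yi].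
by exists (enum_rank i) => //=; rewrite enum_rankK.
Qed.

Lemma covering_number_le A e n :
  ball_cover A e n -> (covering_number A e <= n)%N.
Proof.
move=> An; rewrite /covering_number; case: pselect => // ex.
by case: ex_minnP => m _; apply; exact/asboolP.
Qed.

Lemma covering_numberP A e n :
  ball_cover A e n -> ball_cover A e (covering_number A e).
Proof.
move=> An; rewrite /covering_number; case: pselect => [ex|[]].
  by case: ex_minnP => m /asboolP.
by exists n; exact/asboolP.
Qed.

(** Two points of [A] in the same ball of radius [e] are less than [e + e] apart,
    so a separated family meets each ball of the cover at most once. *)
Lemma packing_le_cover (T : finType) A e n (p : T -> V) :
  (forall i, A (p i)) -> (forall i j, i != j -> e + e <= `|p i - p j|) ->
  ball_cover A e n -> (#|T| <= n)%N.
Proof.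
move=> Ap sep [c Ac].
have /choice[k pk] i : exists k, `|c k - p i| < e.
  by have [k _] := Ac _ (Ap i); rewrite -ball_normE; exists k.
suff inj_k : injective k by rewrite -[n]card_ord; exact: leq_card inj_k.
move=> i j kij; apply/eqP/contraT => /sep; rewrite leNgt => /negP[].
rewrite -[p i](subrK (c (k i))) -addrA (le_lt_trans (ler_normD _ _))//.
by rewrite ltrD //; [rewrite distrC|rewrite kij].
Qed.

End Coverings.

(** * Grids in Euclidean space *)

Section EuclideanCoverings.
Context {R : realType} {d : nat}.
Implicit Types x y : euclid R d.

Lemma coord_le_norm x i : `|(x : 'rV_d) 0 i| <= `|x|.
Proof.
rewrite euclid_normE -sqrtr_sqr ler_wsqrtr// (bigD1 i)//= lerDl.
by apply: sumr_ge0 => j _; exact: sqr_ge0.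
Qed.

(** The sharp factor is the square root of [d]; the cruder [d] only changes
    constants, to which the box dimension is insensitive. *)
Lemma norm_le_coord x s :
  0 <= s -> (forall i, `|(x : 'rV_d) 0 i| <= s) -> `|x| <= d%:R * s.
Proof.
move=> s0 xs; rewrite euclid_normE -[leRHS]ger0_norm ?mulr_ge0// -sqrtr_sqr.
rewrite ler_wsqrtr// (@le_trans _ _ (\sum_(i < d) s ^+ 2))//.
  by apply: ler_sum => i _; rewrite -real_normK ?num_real// lerXn2r// ?nnegrE.
rewrite sumr_const card_ord -[leLHS]mulr_natl exprMn ler_wpM2r ?sqr_ge0//.
by rewrite -natrX ler_nat; case: (d) => // k; rewrite leq_pmulr.
Qed.

(** Rounding each coordinate down to the grid of mesh [e / d.+1] moves a point by
    less than [e]. The mesh uses [d.+1] so that this bound is strict, as balls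
    are open, and so that it makes sense in dimension 0. *)
Lemma grid_cover (L e : R) : 0 <= L -> 0 < e ->
  ball_cover [set y : euclid R d | `|y| <= L] e
    ((Num.truncn (2 * L * d.+1%:R / e)).+1 ^ d).
Proof.
move=> L0 e0; set k := (Num.truncn _).+1.
pose s := e / d.+1%:R; have s0 : 0 < s by rewrite divr_gt0.
pose c (a : {ffun 'I_d -> 'I_k}) : euclid R d := \row_i (s * (a i)%:R - L).
rewrite -[k in (k ^ _)%N]card_ord -[X in (_ ^ X)%N]card_ord -card_ffun.
apply: (@ball_cover_fin _ _ _ _ _ c) => y /= yL.
have yi i : 0 <= (y : 'rV_d) 0 i + L <= 2 * L.
  by have := le_trans (coord_le_norm y i) yL; rewrite ler_norml; lra.
pose m i := Num.truncn (((y : 'rV_d) 0 i + L) / s).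
have mk i : (m i < k)%N.
  rewrite ltnS; apply: le_truncn; rewrite -mulrA -[_ / e]invf_div -/s.
  by rewrite ler_wpM2r ?invr_ge0 ?(ltW s0)//; case/andP: (yi i).
exists [ffun i => Ordinal (mk i)] => //; rewrite -ball_normE /=.
apply: (@le_lt_trans _ _ (d%:R * s)); last first.
  by rewrite /s mulrCA gtr_pMr// ltr_pdivrMr// mul1r ltr_nat.
apply: norm_le_coord => [|i]; first exact: ltW.
rewrite !mxE ffunE /=.
have [y0 _] := andP (yi i).
have /andP[] := truncn_itv (divr_ge0 y0 (ltW s0)).
rewrite ler_pdivlMr// ltr_pdivrMr// -/(m i) -natr1 => a b.
by rewrite ler_norml; lra.
Qed.

End EuclideanCoverings.

(** * Upper box dimension *)

Section BoxDimension.
Context {R : realType}.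
Implicit Types e a : R.

Definition box_ratio (N : nat) e : R := ln N%:R / - ln e.

Lemma upper_box_dim_le (V : normedModType R) (A : set V) a :
  (forall eta, 0 < eta -> exists2 delta, 0 < delta &
    forall e, 0 < e < delta -> box_ratio (covering_number A e) e <= a + eta) ->
  (upper_box_dim A <= a%:E)%E.
Proof.
move=> Aa; apply/lee_addgt0Pr => eta /Aa[delta delta0 Adelta].
apply: ge_ereal_inf; exists (ereal_sup
  [set (box_ratio (covering_number A e) e)%:E | e in [set e | 0 < e < delta]]).
  exists [set e | 0 < e < delta] => //.
  near=> e; apply/andP; split; first by near: e; exact: nbhs_right_gt.
  by near: e; exact: nbhs_right_lt.
by apply: ge_ereal_sup => _ [e /Adelta ? <-]; rewrite -EFinD lee_fin.
Unshelve. all: by end_near. Qed.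

Lemma upper_box_dim_ge (V : normedModType R) (A : set V) a :
  (forall n, exists e, [/\ 0 < e, e < n.+1%:R^-1 &
    a - n.+1%:R^-1 < box_ratio (covering_number A e) e]) ->
  (a%:E <= upper_box_dim A)%E.
Proof.
move=> Aa; apply: le_ereal_inf_tmp => _ [U U0 <-].
apply/lee_addgt0Pr => eta eta0.
have /nbhs_ballP[r /= r0 rU] : nbhs (0 : R) [set e | 0 < e -> U e] by exact: U0.
pose s := Order.min r eta; have s0 : 0 < s by rewrite lt_min r0.
pose n := Num.truncn s^-1.
have ns : n.+1%:R^-1 < s.
  by rewrite invf_plt ?posrE ?ltr0Sn// truncnS_gt.
have [e [e0 en an]] := Aa n.
have Ue : U e.
  apply: rU => //; rewrite -ball_normE /= sub0r normrN gtr0_norm//.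
  by move: ns; rewrite lt_min => /andP[nr _]; exact: lt_trans nr.
apply: (@le_trans _ _ ((box_ratio (covering_number A e) e)%:E + eta%:E)%E).
  rewrite -EFinD lee_fin; move: ns an; rewrite lt_min => /andP[_].
  by move: (_^-1) => q q_eta an; lra.
by rewrite leeD2r//; apply: ereal_sup_ubound; exists e.
Qed.

Lemma upper_box_dim_bounded (d : nat) (A : set (euclid R d)) (L : R) :
  0 <= L -> A `<=` [set y | `|y| <= L] -> (upper_box_dim A <= (d%:R)%:E)%E.
Proof.
move=> L0 AL; pose C := 2 * L * d.+1%:R + 1.
have C1 : 1 <= C by rewrite lerDr !mulr_ge0.
have C0 : 0 < C by lra.
have lnC0 : 0 <= ln C by exact: ln_ge0.
apply: upper_box_dim_le => eta eta0.
have q0 : 0 <= d%:R * ln C / eta by rewrite divr_ge0 ?(ltW eta0)// mulr_ge0.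
exists (expR (- (d%:R * ln C / eta + 1))); first exact: expR_gt0.
move=> e /andP[e0 e_small].
have lne : d%:R * ln C / eta + 1 < - ln e.
  by rewrite ltrNr -[ltRHS]expRK ltr_ln ?posrE ?expR_gt0.
have lne0 : 0 < - ln e by lra.
have e1 : e <= 1 by rewrite -ler_ln ?posrE// ln1; lra.
rewrite /box_ratio ler_pdivrMr//.
set N := covering_number _ _.
have lnN : ln N%:R <= d%:R * (ln C - ln e).
  have [->|N0] := posnP N.
    by rewrite ln0// mulr_ge0//; lra.
  have NK := covering_number_le (ball_coverS AL (grid_cover L0 e0)).
  rewrite -lnV ?posrE// -lnM ?posrE ?invr_gt0//.
  rewrite mulr_natl -lnXn ?divr_gt0//.
  rewrite ler_ln ?posrE ?exprn_gt0 ?divr_gt0 ?ltr0n//.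
  rewrite -(ler_nat R) natrX in NK; apply: le_trans NK _.
  rewrite lerXn2r ?nnegrE ?divr_ge0 ?(ltW e0) ?(ltW C0)//.
  rewrite -natr1 [leRHS]mulrDl lerD//.
    by rewrite truncn_le// !mulr_ge0 ?invr_ge0// ltW.
  by rewrite mul1r invf_ge1.
apply: (le_trans lnN).
have : d%:R * ln C < eta * - ln e.
  by rewrite [ltRHS]mulrC -ltr_pdivrMr//; lra.
lra.
Qed.

(** With e = 1/(8dk) and [N >= k ^ d / m], the ratio [ln N / - ln e] is at least
    [(d * ln k - ln m) / (ln k + ln (8 * d))], which tends to [d] as [k] grows. *)
Lemma box_ratio_near_dim (d m : nat) (eta delta : R) :
  (0 < d)%N -> 0 < eta -> 0 < delta ->
  exists k, [/\ (0 < k)%N, ((8 * d * k)%:R : R)^-1 < delta &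
    forall N, (k ^ d <= m * N)%N ->
      d%:R - eta < box_ratio N (8 * d * k)%:R^-1].
Proof.
move=> d0 eta0 delta0.
(* When [ln k > B], the gain [eta * ln k] outweighs [ln m + d * ln (8 * d)]. *)
pose B := (ln m%:R + d%:R * ln (8 * d)%:R) / eta.
pose k := (Num.truncn (delta^-1 + expR B)).+1.
have k0 : 0 < k%:R :> R by rewrite ltr0n.
have kB : delta^-1 + expR B < k%:R by exact: truncnS_gt.
have d80 : (0 < 8 * d)%N by rewrite muln_gt0.
have d8 : 0 <= ln (8 * d)%:R :> R by rewrite ln_ge0// ler1n.
exists k; split => // [|N kN].
  rewrite invf_plt ?posrE ?ltr0n ?muln_gt0 ?d0//.
  apply: (@lt_le_trans _ _ k%:R); last by rewrite ler_nat leq_pmull.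
  by have := expR_gt0 B; lra.
have lnk : B < ln k%:R.
  rewrite -[ltLHS]expRK ltr_ln ?posrE ?expR_gt0//.
  by have := delta0; rewrite -invr_gt0; lra.
have /andP[m0 N0] : (0 < m)%N && (0 < N)%N.
  by rewrite -muln_gt0 (leq_trans _ kN)// expn_gt0.
have lnkN : d%:R * ln k%:R <= ln m%:R + ln N%:R :> R.
  rewrite mulr_natl -lnXn// -lnM ?posrE ?ltr0n// ler_ln ?posrE ?exprn_gt0//.
    by rewrite -natrX -natrM ler_nat.
  by rewrite mulr_gt0 ?ltr0n.
have lne : - ln ((8 * d * k)%:R^-1 : R) = ln (8 * d)%:R + ln k%:R.
  by rewrite lnV ?posrE ?ltr0n ?muln_gt0 ?d0// opprK natrM lnM ?posrE ?ltr0n.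
have lnk1 : 0 < ln (8 * d)%:R + ln k%:R :> R.
  rewrite -lne -lnV ?posrE ?invr_gt0 ?ltr0n ?muln_gt0 ?d0// invrK ln_gt0//.
  by rewrite ltr1n; apply: (@leq_trans (8 * 1 * 1)%N); rewrite // !leq_mul.
rewrite /box_ratio lne ltr_pdivlMr//.
have : ln m%:R + d%:R * ln (8 * d)%:R < eta * ln k%:R.
  by rewrite [ltRHS]mulrC -ltr_pdivrMr.
have := mulr_ge0 (ltW eta0) d8; lra.
Qed.

End BoxDimension.

(** * Covering numbers of Kakeya sets *)

Section Kakeya.
Context {R : realType} {d : nat}.
Implicit Types f g h : bmap (psphere R d) (euclid R d).

(** The origin also needs a direction, which exists only in positive dimension. *)
Lemma polar_coordinates (y : euclid R d) : (0 < d)%N ->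
  exists t (u : usphere R d), `|t| = `|y| /\ y = t *: val u.
Proof.
move=> d0; have [z z0] : exists z : euclid R d, z != 0.
  exists (const_mx 1 : 'rV_d); apply/eqP => /matrixP/(_ 0 (Ordinal d0))/eqP.
  by rewrite !mxE oner_eq0.
have normalize (w : euclid R d) : w != 0 ->
    exists u : usphere R d, val u = `|w|^-1 *: w.
  move=> w0; have w1 : `| `|w|^-1 *: w | == 1.
    by rewrite normrZ normfV normr_id mulVf ?normr_eq0.
  by exists (exist (fun x : euclid R d => `|x| == 1) _ w1).
have [->|y0] := eqVneq y 0.
  have [u _] := normalize z z0.
  by exists 0, u; rewrite !normr0 scale0r.
have [u uE] := normalize y y0.
exists `|y|, u; rewrite normr_id; split=> //=.
by rewrite uE scalerA divff ?normr_eq0// scale1r.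
Qed.

Lemma kakeya_bounded f : kakeya f `<=` [set y | `|y| <= supnorm f + 1 / 2].
Proof.
rewrite kakeya_reprE => _ [u _ [t /= tI ->]] /=.
rewrite (le_trans (ler_normD _ _))// lerD ?le_supnorm// normrZ.
by rewrite (eqP (valP u)) mulr1 ler_norml; move: tI; rewrite in_itv.
Qed.

Lemma kakeya_covered f e : 0 < e -> exists n, ball_cover (kakeya f) e n.
Proof.
have L0 : 0 <= supnorm f + 1 / 2 by rewrite addr_ge0 ?supnorm_ge0.
by move=> /(grid_cover L0)/(ball_coverS (@kakeya_bounded f)) ?;
  eexists; eassumption.
Qed.

(** A point [y] of the half ball lies on the centred unit segment in its own
    direction [x], and [h x + y] belongs to [kakeya h]. A ball of the given cover
    that contains [h x + y] therefore contains [y] once it is translated by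
    [- c i] and enlarged by the error [`|h x - c i|]. *)
Lemma kakeya_translates_cover h m n (c : 'I_m -> euclid R d) (r s : R) :
  (0 < d)%N -> (forall x, exists i, `|h x - c i| < r) ->
  ball_cover (kakeya h) s n ->
  ball_cover [set y : euclid R d | `|y| <= 1 / 2] (r + s) (m * n).
Proof.
move=> d0 hc [b hb].
rewrite -[m]card_ord -[n]card_ord -card_prod.
apply: (@ball_cover_fin _ _ _ _ _ (fun ij : 'I_m * 'I_n => b ij.2 - c ij.1)).
move=> y /= y2; have [t [u [tE yE]]] := polar_coordinates y d0.
have [i hi] := hc (\pi u).
have [j _ bj] : (\bigcup_j ball (b j) s) (h (\pi u) + t *: val u).
  apply: hb; rewrite kakeya_reprE; exists u => //; exists t => //.
  by rewrite /= in_itv /= -ler_norml tE.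
exists (i, j) => //; move: bj; rewrite -!ball_normE /= -yE => bj.
have -> : b j - c i - y = (h (\pi u) - c i) + (b j - (h (\pi u) + y)).
  by rewrite opprD (addrA (b j)) addrACA [h _ + (_ - _)]addrC subrK addrA.
by rewrite (le_lt_trans (ler_normD _ _))// ltrD.
Qed.

(** The grid of mesh [r + r], with r = 1/(4dk) and [k] points along each axis, fits
    in the ball of radius 1/2 and is separated enough for balls of radius [r]. *)
Lemma half_ball_packing k n : (0 < d)%N -> (0 < k)%N ->
  ball_cover [set y : euclid R d | `|y| <= 1 / 2] (4 * d * k)%:R^-1 n ->
  (k ^ d <= n)%N.
Proof.
move=> d0 k0 covn; set r : R := _^-1 in covn.
have r0 : 0 < r by rewrite invr_gt0 ltr0n !muln_gt0 d0.
pose p (a : {ffun 'I_d -> 'I_k}) : euclid R d := \row_i ((r + r) * (a i)%:R).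
rewrite -[k in (k ^ _)%N]card_ord -[X in (_ ^ X)%N]card_ord -card_ffun.
apply: (packing_le_cover (p := p)) covn => [a|a b ab] /=.
  have -> : 1 / 2 = d%:R * ((r + r) * k%:R).
    have : r * (4 * d%:R * k%:R) = 1.
      by rewrite /r -!natrM mulVf// pnatr_eq0 -lt0n !muln_gt0 d0.
    lra.
  apply: norm_le_coord => [|i]; first by rewrite mulr_ge0// addr_ge0 ?ltW.
  rewrite mxE ger0_norm ?mulr_ge0 ?addr_ge0 ?(ltW r0)//.
  by rewrite ler_wpM2l ?addr_ge0 ?(ltW r0)// ler_nat ltnW.
have [i abi] : exists i, a i != b i.
  apply: contrapT => nab; move/eqP: ab; apply; apply/ffunP => i.
  by apply/eqP/negPn/negP => abi; apply: nab; exists i.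
apply: le_trans (coord_le_norm _ i).
rewrite !mxE -mulrBr normrM gtr0_norm ?addr_gt0// ler_pMr ?addr_gt0//.
rewrite -val_eqE /= neq_ltn in abi.
have dist_ge1 (u v : nat) : (u < v)%N -> 1 <= `|u%:R - v%:R| :> R.
  by move=> uv; rewrite distrC -natrB 1?ltnW// normr_nat ler1n subn_gt0.
by case/orP: abi => /dist_ge1 //; rewrite distrC.
Qed.

(** The error 1/(8dk) of the approximation and the radius 1/(8dk) of the cover
    add up to the radius 1/(4dk) of [half_ball_packing]. *)
Lemma kakeya_covering_number_ge h m k (c : 'I_m -> euclid R d) :
  (0 < d)%N -> (0 < k)%N ->
  (forall x, exists i, `|h x - c i| < (8 * d * k)%:R^-1) ->
  (k ^ d <= m * covering_number (kakeya h) (8 * d * k)%:R^-1)%N.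
Proof.
move=> d0 k0 hc; apply: half_ball_packing => //.
have e0 : 0 < (8 * d * k)%:R^-1 :> R by rewrite invr_gt0 ltr0n !muln_gt0 d0.
have [n covn] := kakeya_covered h e0.
have -> : (4 * d * k)%:R^-1 = (8 * d * k)%:R^-1 + (8 * d * k)%:R^-1 :> R.
  rewrite (_ : 8 * d * k = 2 * (4 * d * k))%N; last by rewrite !mulnA.
  by rewrite [in RHS]natrM invfM; lra.
exact: kakeya_translates_cover hc (covering_numberP covn).
Qed.

(** Round the values of [f] to a finite net of the ball that contains its range;
    as no continuity is required of the maps, the result is admissible. *)
Lemma finite_valued_approx f delta : 0 < delta ->
  exists g m (c : 'I_m -> euclid R d),
    supnorm (f - g) < delta /\ forall x, exists i, g x = c i.
Proof.
move=> delta0; have half0 : 0 < delta / 2 by rewrite divr_gt0.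
have [c fc] := grid_cover (d := d) (supnorm_ge0 f) half0.
have /choice[k ck] x : exists i, `|f x - c i| < delta / 2.
  have [i _] := fc (f x) (le_supnorm f x).
  by rewrite -ball_normE /= distrC; exists i.
have gbnd : c \o k \in
    bounded_map (R := R) (V := euclid R d) (T := psphere R d).
  apply/bounded_mapP; exists (supnorm f + delta / 2) => x /=.
  rewrite -[c (k x)](subrK (f x)) addrC (le_trans (ler_normD _ _))//.
  by rewrite lerD ?le_supnorm// distrC ltW.
exists (BMap gbnd), _, c; split=> [|x]; last by exists (k x).
apply: (@le_lt_trans _ _ (delta / 2)); last by lra.
by apply: supnorm_le => [|x]; [exact: ltW|exact: ltW (ck x)].
Qed.

End Kakeya.

(** * Residuality *)

Theorem theorem6p1 (R : realType) (d : nat) (d_gt0 : (0 < d)%N) :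
  residual [set f : bmap (psphere R d) (euclid R d) |
            upper_box_dim (kakeya f) = (d%:R)%:E].
Proof.
apply: (residual_bigcap (G := fun n => [set f | exists e : R,
  [/\ 0 < e, e < n.+1%:R^-1 & d%:R - n.+1%:R^-1 <
    box_ratio (covering_number (kakeya f) e) e]])); last first.
  move=> f Gf /=; apply/eqP; rewrite eq_le; apply/andP; split.
    apply: upper_box_dim_bounded (@kakeya_bounded _ _ f).
    by rewrite addr_ge0 ?supnorm_ge0.
  by apply: upper_box_dim_ge => n; exact: Gf.
move=> n; apply: nowhere_denseC => f r r0.
have [g [m [c [fg gc]]]] := finite_valued_approx f r0.
have n0 : 0 < n.+1%:R^-1 :> R by rewrite invr_gt0.
have [k [k0 kn kN]] := box_ratio_near_dim m d_gt0 n0 n0.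
have e0 : 0 < (8 * d * k)%:R^-1 :> R by rewrite invr_gt0 ltr0n !muln_gt0 d_gt0.
exists g, (8 * d * k)%:R^-1; split=> // h.
rewrite -ball_normE /= => gh; exists (8 * d * k)%:R^-1; split=> //.
apply/kN/(kakeya_covering_number_ge (c := c)) => // x.
have [i gi] := gc x; exists i; rewrite -gi distrC.
exact: le_lt_trans (le_supnorm (g - h) x) gh.
Qed.
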